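(* Let $A\in\mathbb{R}^{m\times n}$ have nonzero rows and let $b\in\mathbb{R}^m$ be such that the linear system $Ax=b$ is consistent. Let $x^0\in\mathbb{R}^n$ be an arbitrary initial vector and let $x^0_*:=A^\dagger b+(I-A^\dagger A)x^0$. Let $\{x^k\}_{k\geq 0}$ be the sequence generated from $x^0$ by the random reshuffling Kaczmarz (RRK) method. Then for every $k\geq 0$ (and every realization of the random permutations), $$\|x^{k}-x^0_*\|_2\leq \rho_{RRK}^k\,\|x^0-x^0_*\|_2,$$ where $\rho_{RRK}:=\max_{\pi\in S_m}\|T_\pi A^\dagger A\|_2$, and $\rho_{RRK}<1$.
   Context: Notation: $[m]=\{1,\dots,m\}$; $S_m$ is the set of all permutations of $[m]$; $A^\dagger$ is the Moore-Penrose pseudoinverse of $A$; $\|\cdot\|_2$ is the Euclidean norm for vectors and the spectral norm for matrices; $a_i\in\mathbb{R}^n$ is the $i$-th row of $A$ written as a column vector, and $b_i$ is the $i$-th entry of $b$. The convention $0^0=1$ is used. RRK method: given $x^0\in\mathbb{R}^n$, for $k=0,1,2,\dots$ set $x^k_0:=x^k$, generate a random permutation $\pi_k=(\pi_{k,1},\dots,\pi_{k,m})$ of $[m]$, and for $i=1,\dots,m$ set $$x^k_i:=x^k_{i-1}-\frac{\langle a_{\pi_{k,i}},x^k_{i-1}\rangle-b_{\pi_{k,i}}}{\|a_{\pi_{k,i}}\|_2^2}\,a_{\pi_{k,i}};$$ then set $x^{k+1}:=x^k_m$. Iteration matrix: for a permutation $\pi=(\pi_1,\dots,\pi_m)$ of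 $[m]$, $$T_\pi:=\left(I-\frac{a_{\pi_m}a_{\pi_m}^\top}{\|a_{\pi_m}\|_2^2}\right)\cdots\left(I-\frac{a_{\pi_1}a_{\pi_1}^\top}{\|a_{\pi_1}\|_2^2}\right).$$ *)

(* Defs.v *)
From mathcomp Require Import all_boot all_order all_algebra all_fingroup.
From mathcomp Require Import all_classical all_reals.

Set Implicit Arguments.
Unset Strict Implicit.
Unset Printing Implicit Defensive.

Import Order.TTheory GRing.Theory Num.Theory.

Local Open Scope classical_set_scope.
Local Open Scope ring_scope.

Definition dotv (R : realType) (n : nat) (u v : 'cV[R]_n) : R :=
  \sum_i u i 0 * v i 0.

Definition norm2 (R : realType) (n : nat) (u : 'cV[R]_n) : R :=
  Num.sqrt (dotv u u).

(* The operator norm induced by [norm2]; the closed unit ball (rather than the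
   unit sphere) keeps the set nonempty when q = 0.  [spec_norm_has_sup] below
   shows that this [sup] is a genuine supremum. *)
Definition spec_norm (R : realType) (p q : nat) (M : 'M[R]_(p, q)) : R :=
  sup [set norm2 (M *m x) | x in [set x : 'cV[R]_q | norm2 x <= 1]].

Definition is_moore_penrose (R : realType) (m n : nat)
    (A : 'M[R]_(m, n)) (X : 'M[R]_(n, m)) : Prop :=
  [/\ A *m X *m A = A, X *m A *m X = X,
      (A *m X)^T = A *m X & (X *m A)^T = X *m A].

(* Existence and uniqueness are [mp_pinvP] and [moore_penrose_unique]; this is
   not MathComp's [pinvmx], which is only a partial inverse. *)
Definition mp_pinv (R : realType) (m n : nat) (A : 'M[R]_(m, n)) : 'M[R]_(n, m) :=
  xget 0 [set X | is_moore_penrose A X].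

Definition rowv (R : realType) (m n : nat) (A : 'M[R]_(m, n)) (i : 'I_m)
    : 'cV[R]_n := (row i A)^T.

Definition kaczmarz_step (R : realType) (m n : nat) (A : 'M[R]_(m, n))
    (b : 'cV[R]_m) (y : 'cV[R]_n) (i : 'I_m) : 'cV[R]_n :=
  y - ((dotv (rowv A i) y - b i 0) / norm2 (rowv A i) ^+ 2) *: rowv A i.

Definition rrk_epoch (R : realType) (m n : nat) (A : 'M[R]_(m, n))
    (b : 'cV[R]_m) (s : 'S_m) (x : 'cV[R]_n) : 'cV[R]_n :=
  foldl (kaczmarz_step A b) x [seq s i | i <- enum 'I_m].

Fixpoint rrk (R : realType) (m n : nat) (A : 'M[R]_(m, n)) (b : 'cV[R]_m)
    (s : nat -> 'S_m) (x0 : 'cV[R]_n) (k : nat) : 'cV[R]_n :=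
  if k is k'.+1 then rrk_epoch A b (s k') (rrk A b s x0 k') else x0.

Definition row_proj (R : realType) (m n : nat) (A : 'M[R]_(m, n)) (i : 'I_m)
    : 'M[R]_n :=
  1%:M - (norm2 (rowv A i) ^+ 2)^-1 *: (rowv A i *m (rowv A i)^T).

(* The product is ordered left to right; [rev_ord] puts the factor of the last
   processed row s (m-1) leftmost. *)
Definition T_mx (R : realType) (m n : nat) (A : 'M[R]_(m, n)) (s : 'S_m)
    : 'M[R]_n :=
  \prod_(i < m) row_proj A (s (rev_ord i)).

(* 0 is a neutral default: norms are nonnegative and 'S_m is nonempty. *)
Definition rho_RRK (R : realType) (m n : nat) (A : 'M[R]_(m, n)) : R :=
  \big[Num.max/0]_(s : 'S_m) spec_norm (T_mx A s *m mp_pinv A *m A).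

Lemma dotv_ge0 (R : realType) (n : nat) (u : 'cV[R]_n) : 0 <= dotv u u.
Proof. by apply: sumr_ge0 => i _; rewrite -expr2 sqr_ge0. Qed.

Lemma dotv_eq0 (R : realType) (n : nat) (u : 'cV[R]_n) :
  dotv u u = 0 -> u = 0.
Proof.
move=> /eqP; rewrite psumr_eq0 => [/allP u0|i _]; last by rewrite -expr2 sqr_ge0.
apply/matrixP => i j; rewrite ord1 mxE; apply/eqP.
by have := u0 i (mem_index_enum _); rewrite mulf_eq0 orbb.
Qed.

Lemma spec_norm_has_sup (R : realType) (p q : nat) (M : 'M[R]_(p, q)) :
  has_sup [set norm2 (M *m x) | x in [set x : 'cV[R]_q | norm2 x <= 1]].
Proof.
split.
  exists (norm2 (M *m 0)); exists 0 => //=.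
  by rewrite /norm2 /dotv big1 ?sqrtr0 // => i _; rewrite mxE mul0r.
exists (Num.sqrt (\sum_i (\sum_j `|M i j|) ^+ 2)) => _ [x /= x1 <-].
apply/ler_wsqrtr/ler_sum => i _; rewrite -expr2 -real_normK ?num_real //.
rewrite lerXn2r ?nnegrE ?sumr_ge0 // mxE.
apply: le_trans (ler_norm_sum _ _ _) _; apply: ler_sum => j _.
rewrite normrM ler_piMr // -sqrtr_sqr; apply: le_trans x1.
apply: ler_wsqrtr; rewrite /dotv (bigD1 j) //= expr2 lerDl.
by apply: sumr_ge0 => l _; rewrite -expr2 sqr_ge0.
Qed.

Lemma row_free_gram (R : realType) (r n : nat) (F : 'M[R]_(r, n)) :
  row_free F -> F *m F^T \in unitmx.
Proof.
move=> Ff; rewrite -row_free_unit -kermx_eq0; apply/rowV0P => v.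
move=> /sub_kermxP vFF0.
apply: (row_free_inj Ff); rewrite mul0mx; apply: trmx_inj; rewrite trmx0.
apply: dotv_eq0; transitivity ((v *m F *m (v *m F)^T) 0 0).
  by rewrite [RHS]mxE; apply: eq_bigr => i _; rewrite !mxE.
by rewrite trmx_mul -mulmxA (mulmxA F) mulmxA vFF0 mul0mx mxE.
Qed.

Lemma moore_penrose_exists (R : realType) (m n : nat) (A : 'M[R]_(m, n)) :
  exists X, is_moore_penrose A X.
Proof.
have := row_base_free A; have := col_base_full A; have := mulmx_base A.
move: (col_base A) (row_base A); move: (\rank A) => r C F /esym EA fC fF.
have uF : F *m F^T \in unitmx by exact: row_free_gram.
have uC : C^T *m C \in unitmx.
  by rewrite -{2}(trmxK C); apply: row_free_gram; rewrite /row_free mxrank_tr.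
set G := invmx (F *m F^T); set H := invmx (C^T *m C).
have symG : G^T = G by rewrite trmx_inv trmx_mul trmxK.
have symH : H^T = H by rewrite trmx_inv trmx_mul trmxK.
set X := F^T *m G *m H *m C^T.
have AX : A *m X = C *m H *m C^T.
  by rewrite EA /X !mulmxA -(mulmxA C F) -(mulmxA C _ G) mulmxV // mulmx1.
have XA : X *m A = F^T *m G *m F.
  by rewrite EA /X !mulmxA -(mulmxA _ C^T C) -(mulmxA _ H) mulVmx // mulmx1.
exists X; split.
- by rewrite AX {2}EA EA !mulmxA -(mulmxA _ C^T C) -(mulmxA _ H) mulVmx // mulmx1.
- by rewrite XA /X !mulmxA -(mulmxA _ F F^T) -(mulmxA _ (F *m F^T)) mulmxV // mulmx1.
- by rewrite AX !trmx_mul trmxK symH mulmxA.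
- by rewrite XA !trmx_mul trmxK symG mulmxA.
Qed.

Lemma mp_pinvP (R : realType) (m n : nat) (A : 'M[R]_(m, n)) :
  is_moore_penrose A (mp_pinv A).
Proof. exact: (xgetPex 0 (moore_penrose_exists A)). Qed.

Lemma moore_penrose_unique (R : realType) (m n : nat) (A : 'M[R]_(m, n))
    (X Y : 'M[R]_(n, m)) :
  is_moore_penrose A X -> is_moore_penrose A Y -> X = Y.
Proof.
move=> [X1 X2 X3 X4] [Y1 Y2 Y3 Y4].
have AXY : A *m X = A *m Y.
  by rewrite -X3 -{1}Y1 -(mulmxA _ A X) trmx_mul X3 Y3 mulmxA X1.
have XAY : X *m A = Y *m A.
  by rewrite -X4 -{1}Y1 -(mulmxA A) mulmxA trmx_mul X4 Y4 -!mulmxA (mulmxA A) X1.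
by rewrite -X2 XAY -mulmxA AXY mulmxA Y2.
Qed.

(* Main.v *)
Require Import Defs.
From mathcomp Require Import all_boot all_order all_algebra all_fingroup.
From mathcomp Require Import all_classical all_reals.
From mathcomp Require Import ring lra.
Import Order.TTheory GRing.Theory Num.Theory.
Local Open Scope ring_scope.

(** Write Q for the orthogonal projector X A onto the row space of A, where X is
    the pseudoinverse.  The limit point xs solves A x = b, so one epoch acts on
    the error x - xs as the linear map T_s ([rrk_epoch_sub]).  The initial error
    is fixed by Q, and every T_s preserves the vectors fixed by Q
    ([T_mx_fix]) because each step moves along a row of A.  Hence an epoch acts
    on the error as T_s Q, whose spectral norm is at most rho, and the bound
    follows by iteration.

    That rho < 1 is proved with an explicit modulus instead of compactness of
    the sphere.  Projecting v along the row a loses exactly <a,v>^2 / |a|^2 of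
    its energy |v|^2 ([row_proj_energy]).  If a whole sweep loses little energy,
    then each step moves the vector little, so v itself, and not only the
    intermediate iterates, is nearly orthogonal to every row: there is K with
      <a_j, v>^2 <= K (|v|^2 - |T v|^2)   for all j   ([sweep_energy]).
    Summing over j bounds |A v|^2 by the energy loss.  On the row space
    v = X (A v), so |v| is bounded by |X| |A v|, and the two bounds give
    |v|^2 <= L (|v|^2 - |T v|^2) for some L >= 1 that does not depend on v, that
    is, |T v|^2 <= (1 - 1/L) |v|^2 ([spec_norm_T_mx_lt1]).  As there are finitely
    many permutations, the maximum of these norms is below 1 as well. *)

Set Implicit Arguments.
Unset Strict Implicit.
Unset Printing Implicit Defensive.

(** * Euclidean geometry of column vectors *)

Lemma dotvE (R : realType) (n : nat) (u v : 'cV[R]_n) :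
  dotv u v = (u^T *m v) 0 0.
Proof. by rewrite mxE; apply: eq_bigr => i _; rewrite !mxE. Qed.

Lemma dotvC (R : realType) (n : nat) (u v : 'cV[R]_n) : dotv u v = dotv v u.
Proof. by apply: eq_bigr => i _; rewrite mulrC. Qed.

Lemma dotvDr (R : realType) (n : nat) (u v w : 'cV[R]_n) :
  dotv u (v + w) = dotv u v + dotv u w.
Proof. by rewrite !dotvE mulmxDr mxE. Qed.

Lemma dotvZr (R : realType) (n : nat) (c : R) (u v : 'cV[R]_n) :
  dotv u (c *: v) = c * dotv u v.
Proof. by rewrite !dotvE -scalemxAr mxE. Qed.

Lemma dotvDl (R : realType) (n : nat) (u v w : 'cV[R]_n) :
  dotv (u + v) w = dotv u w + dotv v w.
Proof. by rewrite dotvC dotvDr !(dotvC w). Qed.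

Lemma dotvZl (R : realType) (n : nat) (c : R) (u v : 'cV[R]_n) :
  dotv (c *: u) v = c * dotv u v.
Proof. by rewrite dotvC dotvZr dotvC. Qed.

Lemma dotv_mulmx (R : realType) (p q : nat) (M : 'M[R]_(p, q)) u v :
  dotv (M *m u) v = dotv u (M^T *m v).
Proof. by rewrite !dotvE trmx_mul mulmxA. Qed.

Lemma norm2_ge0 (R : realType) (n : nat) (u : 'cV[R]_n) : 0 <= norm2 u.
Proof. exact: sqrtr_ge0. Qed.

Lemma norm2_sqr (R : realType) (n : nat) (u : 'cV[R]_n) :
  norm2 u ^+ 2 = dotv u u.
Proof. by rewrite sqr_sqrtr ?dotv_ge0. Qed.

Lemma norm2Z (R : realType) (n : nat) (c : R) (u : 'cV[R]_n) :
  norm2 (c *: u) = `|c| * norm2 u.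
Proof.
by rewrite /norm2 dotvZl dotvZr mulrA -expr2 sqrtrM ?sqr_ge0 // sqrtr_sqr.
Qed.

Lemma norm2_eq0 (R : realType) (n : nat) (u : 'cV[R]_n) :
  norm2 u = 0 -> u = 0.
Proof. by move=> u0; apply: dotv_eq0; rewrite -norm2_sqr u0 expr0n. Qed.

Lemma norm2_0 (R : realType) (n : nat) : norm2 (0 : 'cV[R]_n) = 0.
Proof. by rewrite -(scale0r 0) norm2Z normr0 mul0r. Qed.

(** A symmetric idempotent is an orthogonal projector: |x|^2 exceeds |Q x|^2 by
    |x - Q x|^2. *)
Lemma dotv_sym_idem_le (R : realType) (n : nat) (Q : 'M[R]_n) (x : 'cV[R]_n) :
  Q^T = Q -> Q *m Q = Q -> dotv (Q *m x) (Q *m x) <= dotv x x.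
Proof.
move=> symQ idQ.
have QxQx : dotv (Q *m x) (Q *m x) = dotv x (Q *m x).
  by rewrite dotv_mulmx symQ mulmxA idQ.
have := dotv_ge0 (x + (-1) *: (Q *m x)).
rewrite !(dotvDl, dotvDr, dotvZl, dotvZr) (dotvC _ x) QxQx; lra.
Qed.

(** * The spectral norm as an operator norm *)

Lemma norm2_mulmx_le (R : realType) (p q : nat) (M : 'M[R]_(p, q)) x :
  norm2 (M *m x) <= spec_norm M * norm2 x.
Proof.
have [x0|xN0] := eqVneq (norm2 x) 0.
  by rewrite (norm2_eq0 x0) mulmx0 !norm2_0 mulr0.
have xgt0 : 0 < norm2 x by rewrite lt_def xN0 norm2_ge0.
rewrite -ler_pdivrMr //; apply: sup_upper_bound; first exact: spec_norm_has_sup.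
exists ((norm2 x)^-1 *: x) => /=.
  by rewrite norm2Z ger0_norm ?invr_ge0 ?norm2_ge0 // mulVf.
by rewrite -scalemxAr norm2Z ger0_norm ?invr_ge0 ?norm2_ge0 // mulrC.
Qed.

Lemma spec_norm_ge0 (R : realType) (p q : nat) (M : 'M[R]_(p, q)) :
  0 <= spec_norm M.
Proof.
apply: sup_upper_bound; first exact: spec_norm_has_sup.
by exists 0; rewrite /= ?mulmx0 norm2_0.
Qed.

Lemma spec_norm_le (R : realType) (p q : nat) (M : 'M[R]_(p, q)) (c : R) :
  0 <= c -> (forall x, norm2 (M *m x) <= c * norm2 x) -> spec_norm M <= c.
Proof.
move=> c0 Mc; apply: ge_sup; first by have [] := spec_norm_has_sup M.
by move=> _ [x /= x1 <-]; apply: le_trans (Mc x) _; rewrite ler_piMr.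
Qed.

(** * Energy dissipated by one sweep *)

(** Indexed by an arbitrary list rather than a permutation, so that properties
    of an epoch can be proved by induction on its steps. *)
Definition sweep (R : realType) (m n : nat) (A : 'M[R]_(m, n))
    (l : seq 'I_m) (v : 'cV[R]_n) : 'cV[R]_n :=
  foldl (fun y i => row_proj A i *m y) v l.

Lemma mulmx_rowv (R : realType) (m n : nat) (A : 'M[R]_(m, n)) v i :
  (A *m v) i 0 = dotv (rowv A i) v.
Proof. by rewrite mxE; apply: eq_bigr => j _; rewrite !mxE. Qed.

Lemma rowv_gt0 (R : realType) (m n : nat) (A : 'M[R]_(m, n)) i :
  row i A != 0 -> 0 < dotv (rowv A i) (rowv A i).
Proof.
move=> Ai0; rewrite lt_def dotv_ge0 andbT.
apply: contra Ai0 => /eqP/dotv_eq0/(congr1 trmx).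
by rewrite trmxK trmx0 => ->.
Qed.

Lemma row_proj_mulmx (R : realType) (m n : nat) (A : 'M[R]_(m, n)) i v :
  row_proj A i *m v =
  v - (dotv (rowv A i) v / norm2 (rowv A i) ^+ 2) *: rowv A i.
Proof.
rewrite /row_proj mulmxBl mul1mx -scalemxAl -mulmxA.
rewrite [(rowv A i)^T *m v]mx11_scalar -dotvE mul_mx_scalar scalerA.
by rewrite mulrC.
Qed.

(** Pythagoras: the component of [v] along the unit vector a / |a| is removed. *)
Lemma row_proj_energy (R : realType) (m n : nat) (A : 'M[R]_(m, n)) i v :
  row i A != 0 ->
  dotv (row_proj A i *m v) (row_proj A i *m v) =
  dotv v v - dotv (rowv A i) v ^+ 2 / dotv (rowv A i) (rowv A i).
Proof.
move=> /rowv_gt0/lt0r_neq0 aN0.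
rewrite row_proj_mulmx norm2_sqr -scaleNr.
rewrite !(dotvDl, dotvDr, dotvZl, dotvZr) (dotvC v).
by field.
Qed.

(** Induction on the list.  With w the image of [v] under the first projection,
    along the row a, one has v = w + c a where c^2 |a|^2 is the energy lost in
    that first step; so <a_j,v>^2 <= 2 <a_j,w>^2 + 2 c^2 <a_j,a>^2, where the
    first term is controlled by the loss of the later steps and the second by
    the loss of the first step. *)
Lemma sweep_energy (R : realType) (m n : nat) (A : 'M[R]_(m, n)) l :
  (forall i, row i A != 0) ->
  exists2 K : R, 0 <= K & forall v,
    dotv (sweep A l v) (sweep A l v) <= dotv v v /\
    {in l, forall j, dotv (rowv A j) v ^+ 2
       <= K * (dotv v v - dotv (sweep A l v) (sweep A l v))}.
Proof.
move=> A_rows; elim: l => [|i l [K K0 IH]]; first by exists 0.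
set a := rowv A i.
pose B := \sum_j dotv (rowv A j) a ^+ 2 / dotv a a.
have Bge j : dotv (rowv A j) a ^+ 2 / dotv a a <= B.
  rewrite /B (bigD1 j) //= lerDl sumr_ge0 // => h _.
  by rewrite divr_ge0 ?sqr_ge0 ?dotv_ge0.
have B0 : 0 <= B.
  by apply: le_trans (Bge i); rewrite divr_ge0 ?sqr_ge0 ?dotv_ge0.
exists (2 * K + 2 * B) => [|v]; first by rewrite addr_ge0 ?mulr_ge0.
have E := row_proj_energy v (A_rows i).
rewrite -/a in E.
rewrite /= -/(sweep A l _); set w := row_proj A i *m v in E *.
have [Tw wj] := IH w.
have aN0 : dotv a a != 0 by rewrite lt0r_neq0 ?rowv_gt0.
have D0 : 0 <= dotv a v ^+ 2 / dotv a a by rewrite divr_ge0 ?sqr_ge0 ?dotv_ge0.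
set D := dotv a v ^+ 2 / dotv a a in E D0.
set t := dotv (sweep A l w) _ in Tw wj *.
have vw : dotv v v = dotv w w + D by rewrite E subrK.
split; first by rewrite vw; lra.
have KE : 0 <= K * (dotv w w - t) by rewrite mulr_ge0 ?subr_ge0.
have KD : 0 <= K * D by rewrite mulr_ge0.
have BD : 0 <= B * D by rewrite mulr_ge0.
have BE : 0 <= B * (dotv w w - t) by rewrite mulr_ge0 ?subr_ge0.
move=> j; rewrite inE => /predU1P[-> | /wj wjle].
  rewrite -/a.
  (* |a|^2 is the term of index i in the sum defining B. *)
  have aB : dotv a a <= B.
    by apply: le_trans (Bge i); rewrite -/a expr2 mulfK.
  have DE : dotv a v ^+ 2 = dotv a a * D by rewrite /D mulrC divfK.
  have : dotv a a * D <= B * D by rewrite ler_wpM2r.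
  rewrite DE vw; nra.
have -> : dotv (rowv A j) v =
    dotv (rowv A j) w + dotv a v / dotv a a * dotv (rowv A j) a.
  rewrite /w row_proj_mulmx norm2_sqr -scaleNr dotvDr dotvZr -/a; ring.
set y := dotv (rowv A j) w in wjle *.
set z := _ / _ * _.
have zD : z ^+ 2 <= B * D.
  have -> : z ^+ 2 = (dotv (rowv A j) a ^+ 2 / dotv a a) * D.
    by rewrite /z /D; field.
  by rewrite ler_wpM2r.
have := sqr_ge0 (y - z).
rewrite vw; nra.
Qed.

Lemma rev_enum_ord_map (m : nat) :
  rev (enum 'I_m) = map (@rev_ord m) (enum 'I_m).
Proof.
apply: (inj_map val_inj); rewrite map_rev val_enum_ord -map_comp.
apply: (@eq_from_nth _ 0%N) => [|i]; rewrite size_rev size_iota.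
  by rewrite size_map size_enum_ord.
move=> im; rewrite nth_rev ?size_iota // nth_iota ?rev_ord_proof //.
  by rewrite (nth_map (Ordinal im)) ?size_enum_ord //= nth_enum_ord.
by rewrite ltn_subrL /= (leq_ltn_trans _ im).
Qed.

Lemma sweep_prod (R : realType) (m n : nat) (A : 'M[R]_(m, n)) l v :
  sweep A l v = (\prod_(i <- rev l) row_proj A i : 'M[R]_n) *m v.
Proof.
elim: l v => [|i l IH] v /=; first by rewrite big_nil mul1mx.
by rewrite rev_cons -cats1 big_cat big_seq1 IH /= mulmxA.
Qed.

(** The reversed index in [T_mx] makes the factor of the first processed row the
    rightmost one, hence the first to act on [v]. *)
Lemma T_mx_mulmx (R : realType) (m n : nat) (A : 'M[R]_(m, n)) (s : 'S_m) v :
  T_mx A s *m v = sweep A [seq s i | i <- enum 'I_m] v.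
Proof.
rewrite sweep_prod -map_rev big_map rev_enum_ord_map big_map /T_mx.
by rewrite enumT [index_enum _]unlock.
Qed.

(** * Strict contraction on the row space *)

(** On the row space |v| <= |X| |A v|, which turns the bound of [sweep_energy] on
    the entries of A v into a loss of a fixed proportion of |v|^2. *)
Lemma spec_norm_T_mx_lt1 (R : realType) (m n : nat) (A : 'M[R]_(m, n)) s :
  (forall i, row i A != 0) -> spec_norm (T_mx A s *m mp_pinv A *m A) < 1.
Proof.
move=> A_rows; have [AXA XAX _ symQ] := mp_pinvP A.
set X := mp_pinv A in AXA XAX symQ *.
have [K K0 TK] := sweep_energy [seq s i | i <- enum 'I_m] A_rows.
(* The summand 1 keeps 1 - 1/L a well-defined nonnegative factor even if K = 0. *)
pose L := spec_norm X ^+ 2 * (m%:R * K) + 1.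
have L1 : 1 <= L by rewrite lerDr mulr_ge0 ?sqr_ge0 // mulr_ge0.
have Lgt0 : 0 < L by lra.
have L0 : 0 <= 1 - L^-1 by rewrite subr_ge0 invf_le1.
apply: (@le_lt_trans _ _ (Num.sqrt (1 - L^-1))); last first.
  rewrite -[ltRHS]sqrtr1 ltr_sqrt ?ltr01 //.
  by rewrite gtrBl invr_gt0.
apply: spec_norm_le => [|x]; first exact: sqrtr_ge0.
rewrite -sqrtrM // ler_wsqrtr //.
have -> : T_mx A s *m X *m A *m x = T_mx A s *m (X *m A *m x).
  by rewrite !mulmxA.
set v := X *m A *m x.
have vx : dotv v v <= dotv x x.
  by apply: dotv_sym_idem_le; rewrite ?mulmxA ?XAX.
apply: le_trans (_ : (1 - L^-1) * dotv v v <= _); last by rewrite ler_wpM2l.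
have [Tv vj] := TK v.
rewrite -T_mx_mulmx in Tv vj.
set t := dotv (T_mx A s *m v) _ in Tv vj *.
have Av : dotv (A *m v) (A *m v) <= m%:R * K * (dotv v v - t).
  have -> : m%:R * K * (dotv v v - t) = \sum_(i < m) K * (dotv v v - t).
    by rewrite sumr_const card_ord -mulrA mulr_natl.
  apply: ler_sum => i _.
  rewrite mulmx_rowv -expr2; apply: vj.
  by rewrite -[i](permKV s) map_f ?mem_enum.
have vAv : dotv v v <= spec_norm X ^+ 2 * dotv (A *m v) (A *m v).
  have vE : X *m (A *m v) = v by rewrite /v !mulmxA XAX.
  rewrite -{1 2}vE -!norm2_sqr -exprMn.
  rewrite lerXn2r ?nnegrE ?norm2_mulmx_le ?norm2_ge0 //.
  by rewrite mulr_ge0 ?spec_norm_ge0 ?norm2_ge0.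
have vL : dotv v v <= L * (dotv v v - t).
  have := ler_wpM2l (sqr_ge0 (spec_norm X)) Av.
  rewrite /L; nra.
have : dotv v v / L <= dotv v v - t by rewrite ler_pdivrMr // mulrC.
rewrite mulrBl mul1r [L^-1 * _]mulrC; lra.
Qed.

Lemma rho_RRK_lt1 (R : realType) (m n : nat) (A : 'M[R]_(m, n)) :
  (forall i, row i A != 0) -> rho_RRK A < 1.
Proof.
by move=> A_rows; apply: bigmax_lt => [|s _]; rewrite ?ltr01 ?spec_norm_T_mx_lt1.
Qed.

(** * Propagation of the error *)

Lemma kaczmarz_step_sub (R : realType) (m n : nat) (A : 'M[R]_(m, n)) b z y i :
  A *m z = b -> kaczmarz_step A b y i - z = row_proj A i *m (y - z).
Proof.
move=> Az; rewrite row_proj_mulmx /kaczmarz_step.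
rewrite -Az mulmx_rowv.
have -> : dotv (rowv A i) (y - z) = dotv (rowv A i) y - dotv (rowv A i) z.
  by rewrite -scaleN1r dotvDr dotvZr mulN1r.
by rewrite addrAC.
Qed.

(** Any solution [z] serves as the origin of the error, since the offsets b_i
    equal <a_i, z>. *)
Lemma rrk_epoch_sub (R : realType) (m n : nat) (A : 'M[R]_(m, n)) b z s y :
  A *m z = b -> rrk_epoch A b s y - z = T_mx A s *m (y - z).
Proof.
move=> Az; rewrite T_mx_mulmx /rrk_epoch.
elim: [seq _ | _ <- _] y => //= i l IH y.
by rewrite IH kaczmarz_step_sub.
Qed.

(** The hypotheses say that Q fixes the rows of [A], which span all the
    corrections made during a sweep. *)
Lemma T_mx_fix (R : realType) (m n : nat) (A : 'M[R]_(m, n)) (Q : 'M[R]_n) s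
    (v : 'cV[R]_n) :
  Q^T = Q -> A *m Q = A -> Q *m v = v -> Q *m (T_mx A s *m v) = T_mx A s *m v.
Proof.
move=> symQ AQ; rewrite T_mx_mulmx; elim: [seq _ | _ <- _] v => //= i l IH v Qv.
apply: IH; rewrite row_proj_mulmx mulmxBr Qv -scalemxAr.
by rewrite /rowv -symQ -trmx_mul -row_mul AQ.
Qed.

(** * Convergence of the iterates *)

Theorem corollary3p3 (R : realType) (m n : nat) (A : 'M[R]_(m, n))
    (b : 'cV[R]_m) (x0 : 'cV[R]_n)
    (A_rows : forall i : 'I_m, row i A != 0)
    (consistent : exists x : 'cV[R]_n, A *m x = b) :
  let xs := mp_pinv A *m b + (1%:M - mp_pinv A *m A) *m x0 in
  (forall (s : nat -> 'S_m) (k : nat),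
     norm2 (rrk A b s x0 k - xs) <= rho_RRK A ^+ k * norm2 (x0 - xs))
  /\ rho_RRK A < 1.
Proof.
move=> xs; split; last exact: rho_RRK_lt1.
have [AXA XAX _ symQ] := mp_pinvP A.
set X := mp_pinv A in AXA XAX symQ xs *.
have Axs : A *m xs = b.
  have [x Ax] := consistent.
  have AQ0 : A *m (1%:M - X *m A) = 0 by rewrite mulmxBr mulmx1 mulmxA AXA subrr.
  by rewrite /xs mulmxDr !mulmxA AQ0 mul0mx addr0 -Ax mulmxA AXA.
have Qe0 : X *m A *m (x0 - xs) = x0 - xs.
  have -> : x0 - xs = X *m (A *m x0 - b).
    rewrite /xs mulmxBl mul1mx mulmxBr mulmxA opprD opprB.
    by rewrite addrCA [x0 + _]addrC subrK addrC.
  by rewrite mulmxA XAX.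
move=> s k.
have Qe j : X *m A *m (rrk A b s x0 j - xs) = rrk A b s x0 j - xs.
  elim: j => //= j IH; rewrite rrk_epoch_sub //; apply: T_mx_fix => //.
  by rewrite mulmxA.
have rho0 : 0 <= rho_RRK A by exact: bigmax_ge_id.
elim: k => [|k IH]; first by rewrite expr0 mul1r.
rewrite /= rrk_epoch_sub // -Qe !mulmxA exprS -mulrA.
apply: le_trans (norm2_mulmx_le _ _) _.
apply: ler_pM; rewrite ?norm2_ge0 //; last first.
  exact: (le_bigmax _ (fun t => spec_norm (T_mx A t *m X *m A))).
exact: spec_norm_ge0.
Qed.
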